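(* Let $k \geq 2$ be an integer, let $\mathbf{x} = x_0x_1x_2\cdots$ be a $k$-automatic sequence, and let $\mathbf{a}$ be a Sturmian sequence. Then there exists a constant $C$ (depending on $\mathbf{x}$ and $\mathbf{a}$) such that if $\mathbf{x}$ and $\mathbf{a}$ have a factor in common of length $n$, then $n \leq C$.
   Context: A sequence $\mathbf{x} = (x_n)_{n\ge 0}$ over a finite alphabet is $k$-automatic if there is a deterministic finite automaton with output which, reading the base-$k$ representation of $n$, outputs $x_n$; equivalently, its $k$-kernel $\{(x_{nk^r+s})_{n\ge 0} : r\ge 0,\ 0\le s<k^r\}$ is finite. A Sturmian sequence is a binary sequence given by the first differences of a sequence of the form $(\lfloor n\alpha+\beta\rfloor)_{n\ge 1}$, i.e. $a_n = \lfloor (n+1)\alpha+\beta\rfloor - \lfloor n\alpha+\beta\rfloor$, where $0\le \alpha,\beta<1$ and $\alpha$ is irrational. A factor of a sequence is a finite contiguous block of its symbols; $\mathbf{x}$ and $\mathbf{a}$ have a factor of length $n$ in common if some word of length $n$ occurs as a contiguous block in both sequences. *)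

(* Defs.v *)
From HB Require Import structures.
From mathcomp Require Import all_boot all_order all_algebra.
From mathcomp Require Import boolp classical_sets reals.
Set Implicit Arguments.
Unset Strict Implicit.
Unset Printing Implicit Defensive.
Import Order.TTheory GRing.Theory Num.Theory.

Record dfao (k : nat) (T : Type) := Dfao {
  dfao_state : finType;
  dfao_init : dfao_state;
  dfao_trans : dfao_state -> 'I_k -> dfao_state;
  dfao_out : dfao_state -> T
}.

Definition dfao_run (k : nat) (T : Type) (M : dfao k T) (w : seq 'I_k) : T :=
  dfao_out (foldl (@dfao_trans k T M) (dfao_init M) w).

Definition word_value (k : nat) (w : seq 'I_k) : nat :=
  foldl (fun (m : nat) (d : 'I_k) => m * k + d)%N 0%N w.

(* Most significant digit first, without leading zeros; the integer 0 is
   represented by the empty word. *)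
Definition base_repr (k : nat) (n : nat) (w : seq 'I_k) : Prop :=
  word_value w = n /\ (forall (d : 'I_k) (v : seq 'I_k), w = d :: v -> d <> 0%N :> nat).

Lemma base_repr_exists (k : nat) (hk : (2 <= k)%N) (n : nat) :
  exists w : seq 'I_k, base_repr n w.
Proof.
elim/ltn_ind: n => -[_|n IH]; first by exists [::].
have k0 : (0 < k)%N by exact: ltnW.
have [w [vw hw]] := IH (n.+1 %/ k)%N (ltn_Pdiv hk (ltn0Sn n)).
exists (rcons w (Ordinal (ltn_pmod n.+1 k0))); split.
  by rewrite /word_value -cats1 foldl_cat /= -/(word_value w) vw -divn_eq.
case: w vw hw => [|e w] vw hw d v [<- _]; last exact: hw.
by move=> /= r0; have := divn_eq n.+1 k; rewrite -vw r0.
Qed.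

(* [T] may be infinite: the finite alphabet of [x] is the image of [dfao_out]. *)
Definition automatic (k : nat) (T : Type) (x : nat -> T) : Prop :=
  exists M : dfao k T, forall (n : nat) (w : seq 'I_k),
    base_repr n w -> x n = dfao_run M w.

(* The sequence (a_m)_{m >= 1} is indexed from 0: [a n] is
   a_{n+1} = floor ((n+2) alpha + beta) - floor ((n+1) alpha + beta). *)
Definition sturmian (R : realType) (a : nat -> int) : Prop :=
  exists alpha beta : R,
    [/\ (0 <= alpha < 1)%R, (0 <= beta < 1)%R, irrational alpha
      & forall n : nat,
          a n = (Num.floor (n.+2%:R * alpha + beta)
                 - Num.floor (n.+1%:R * alpha + beta))%R].

Definition factor (T : Type) (w : seq T) (x : nat -> T) : Prop :=
  exists i : nat, w = mkseq (fun j => x (i + j)%N) (size w).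

Definition common_factor (T : Type) (x a : nat -> T) (n : nat) : Prop :=
  exists w : seq T, [/\ size w = n, factor w x & factor w a].

(* Main.v *)
Require Import Defs.
From mathcomp Require Import all_boot all_order all_algebra.
From mathcomp Require Import boolp classical_sets reals.
From mathcomp Require Import zify ring lra.

(** Prolonging the representation of [n >= 1] by [r] digits of value [s] acts
    on the states of the automaton by a map depending only on the digits, and
    there are finitely many such maps; hence for [r] large there are
    [s < t < k ^ r] with [x (n k^r + s) = x (n k^r + t)] for all [n >= 1].
    For a Sturmian sequence the corresponding equality fails whenever
    [(n k^r + c) alpha] falls, modulo 1, in a fixed interval of positive
    length, and the rotation by [k^r alpha] visits such an interval within a
    number of steps that does not depend on the starting point. *)

Set Implicit Arguments.
Unset Strict Implicit.
Unset Printing Implicit Defensive.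
Import Order.TTheory GRing.Theory Num.Theory.

(** * Digit words and the pigeonhole on automaton states *)

Lemma word_value_cat (k : nat) (v w : seq 'I_k) :
  word_value (v ++ w) = (word_value v * k ^ size w + word_value w)%N.
Proof.
elim/last_ind: w => [|w d IH]; first by rewrite cats0 muln1 addn0.
have vrc u : word_value (rcons u d) = (word_value u * k + d)%N.
  by rewrite /word_value foldl_rcons.
rewrite -rcons_cat !vrc IH size_rcons expnSr.
by rewrite mulnDl mulnA addnA.
Qed.

(** Leading zeros are allowed, unlike in [base_repr]: all suffixes appended to a representation must
    have the same length [r]. *)
Lemma word_of_size_exists (k r s : nat) : (s < k ^ r)%N ->
  exists2 w : seq 'I_k, size w = r & word_value w = s.
Proof.
elim: r s => [|r IH] s hs.
  by exists [::] => //; move: hs; rewrite expn0; case: s.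
have k0 : (0 < k)%N by case: k hs {IH} => // ; rewrite exp0n.
have [|w sw vw] := IH (s %/ k)%N; first by rewrite ltn_divLR // -expnSr.
exists (rcons w (Ordinal (ltn_pmod s k0))); first by rewrite size_rcons sw.
by rewrite /word_value foldl_rcons -/(word_value w) vw /= -divn_eq.
Qed.

(** Since [0 < n], the word [v] is nonempty and supplies the leading digit, so zeros at the front of
    [w] are harmless. *)
Lemma base_repr_cat (k n : nat) (v w : seq 'I_k) : (0 < n)%N ->
  base_repr n v -> base_repr (n * k ^ size w + word_value w) (v ++ w).
Proof.
move=> n0 [vv hv]; split; first by rewrite word_value_cat vv.
case: v vv hv => [|e v] vv hv d u; first by rewrite -vv in n0.
by case=> <- _; exact: (hv e v).
Qed.

Lemma automatic_kernel_collision (k : nat) (T : Type) (x : nat -> T) :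
  (2 <= k)%N -> automatic k x ->
  exists r s t : nat, [/\ (s < t)%N, (t < k ^ r)%N &
    forall n, (0 < n)%N -> x (n * k ^ r + s)%N = x (n * k ^ r + t)%N].
Proof.
move=> hk [M hM]; pose Q := dfao_state M.
(* As [r < k ^ r], there are more words of length [r] than self-maps of [Q], so two words act
   alike. *)
pose r := #|{ffun Q -> Q}|.
have hw (s : 'I_(k ^ r)) :
    {w : seq 'I_k | size w = r /\ word_value w = s}.
  apply: cid; have [w sw vw] := word_of_size_exists (ltn_ord s).
  by exists w.
pose act (s : 'I_(k ^ r)) : {ffun Q -> Q} :=
  [ffun q => foldl (@dfao_trans k T M) q (sval (hw s))].
have xE n (s : 'I_(k ^ r)) v : (0 < n)%N -> base_repr n v ->
    x (n * k ^ r + s)%N =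
    dfao_out (act s (foldl (@dfao_trans k T M) (dfao_init M) v)).
  move=> n0 nv; rewrite ffunE; case: (hw s) => w [sw vw] /=.
  have := base_repr_cat w n0 nv; rewrite sw vw => /hM ->.
  by rewrite /dfao_run foldl_cat.
have /injectivePn [s [t st actE]] : ~~ injectiveb act.
  apply/negP => /injectiveP /leq_card; rewrite card_ord leqNgt.
  by rewrite ltn_expl.
have collide n : (0 < n)%N -> x (n * k ^ r + s)%N = x (n * k ^ r + t)%N.
  move=> n0; have [v nv] := base_repr_exists hk n.
  by rewrite (xE n s v) // (xE n t v) // actE.
move: st; rewrite neq_ltn => /orP[st|ts].
  by exists r, s, t; split.
by exists r, t, s; split => // n /collide.
Qed.

Local Open Scope ring_scope.

(** * Return times of irrational rotations *)

Lemma irrational_natmul_neq (R : realType) (a : R) (n : nat) (z : int) :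
  irrational a -> (0 < n)%N -> n%:R * a != z%:~R.
Proof.
move=> ia n0; apply/negP => /eqP e; apply: ia.
exists (z%:~R / n%:R) => //=.
rewrite fmorph_div /= ratr_int ratr_nat -e mulrC mulKf //.
by rewrite pnatr_eq0 -lt0n.
Qed.

(** Pigeonhole: among [K + 1] fractional parts of multiples of [g], two share one of the [K] boxes
    of width [1 / K < e]. *)
Lemma dirichlet_small_multiple (R : realType) (g e : R) :
  (forall (n : nat) (z : int), (0 < n)%N -> n%:R * g != z%:~R) -> 0 < e ->
  exists (q : nat) (p : int), 0 < `|q%:R * g - p%:~R| < e.
Proof.
move=> ig e0; pose K := (Num.truncn e^-1).+1.
have K0 : 0 < K%:R :> R by rewrite ltr0n.
have Ke : K%:R^-1 < e by rewrite invf_plt ?posrE // truncnS_gt.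
pose f (i : nat) : R := i%:R * g - (Num.floor (i%:R * g))%:~R.
have f01 i : 0 <= f i < 1.
  have := floor_itv (i%:R * g); rewrite /f intrD; lra.
have fK i : 0 <= K%:R * f i by case/andP: (f01 i) => ? _; rewrite mulr_ge0.
have hlt i : (Num.truncn (K%:R * f i) < K)%N.
  rewrite truncn_lt_nat // gtr_pMr //; by case/andP: (f01 i).
pose h (i : 'I_K.+1) : 'I_K := Ordinal (hlt i).
have /injectivePn [i [j ij hij]] : ~~ injectiveb h.
  by apply/negP => /injectiveP /leq_card; rewrite !card_ord ltnn.
have {hij} hij : Num.truncn (K%:R * f i) = Num.truncn (K%:R * f j).
  by case: hij.
wlog lt_ij : i j ij hij / (i < j)%N.
  move=> H; move: (ij); rewrite neq_ltn => /orP[]; first exact: H.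
  by apply: H => //; rewrite eq_sym.
have fd : f j - f i =
    (j - i)%N%:R * g -
    (Num.floor (j%:R * g) - Num.floor (i%:R * g))%:~R.
  by rewrite /f natrB 1?ltnW // intrB; ring.
exists (j - i)%N, (Num.floor (j%:R * g) - Num.floor (i%:R * g)).
rewrite -fd normr_gt0 {1}fd subr_eq0 ig ?subn_gt0 //=.
apply: lt_trans Ke; rewrite -(ltr_pM2l K0) mulfV ?gt_eqF //.
rewrite -{1}(gtr0_norm K0) -normrM mulrBr.
have := truncn_itv (fK i); have := truncn_itv (fK j).
rewrite hij -natr1 ltr_norml; lra.
Qed.

(** Steps shorter than the interval cannot jump over it, and the next translate of [u] is at
    distance at most 1 from any [x]. *)
Lemma positive_step_hits (R : realType) (u e h : R) : 0 < h < e ->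
  exists N : nat, forall x : R, exists (n : nat) (z : int),
    (n <= N)%N /\ u + z%:~R <= x + n%:R * h < u + z%:~R + e.
Proof.
move=> /andP[h0 he]; exists (Num.truncn h^-1).+1 => x.
pose z := Num.floor (x - u) + 1; pose y : R := u + z%:~R.
have hy : 0 < y - x <= 1.
  have := floor_itv (x - u); rewrite /y /z intrD; lra.
have d0 : 0 <= (y - x) / h by rewrite divr_ge0 //; lra.
(* This is the first step strictly past [y]; it overshoots by at most [h < e]. *)
exists (Num.truncn ((y - x) / h)).+1, z; split.
  rewrite ltnS; apply: le_truncn.
  by rewrite -[leRHS]mul1r ler_wpM2r ?invr_ge0; lra.
have /andP[lo hi] := truncn_itv d0.
move: lo hi; rewrite ler_pdivlMr // ltr_pdivrMr // -natr1 -/y; lra.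
Qed.

Lemma rotation_hits_interval (R : realType) (g u e : R) :
  (forall (n : nat) (z : int), (0 < n)%N -> n%:R * g != z%:~R) -> 0 < e ->
  exists N : nat, forall x : R, exists (n : nat) (z : int),
    (n <= N)%N /\ u + z%:~R <= x + n%:R * g < u + z%:~R + e.
Proof.
move=> ig e0; have [q [p /andP[d0 de]]] := dirichlet_small_multiple ig e0.
have [N hN] := positive_step_hits u (introT andP (conj d0 de)).
(* Modulo 1, [q] rotations by [g] make one step of length below [e]. *)
exists (N * q)%N => x; case: (leP 0 (q%:R * g - p%:~R)) => sg.
  have [n [z [nN]]] := hN x; rewrite ger0_norm // => H.
  exists (n * q)%N, (z + n%:Z * p); split; first by rewrite leq_mul2r nN orbT.
  by move: H; rewrite natrM intrD intrM; lra.
(* A negative step is a positive one run backwards from the [N]-th point. *)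
have [n [z [nN]]] := hN (x + N%:R * (q%:R * g - p%:~R)).
rewrite ltr0_norm // => H.
exists ((N - n) * q)%N, (z + (N - n)%N%:Z * p); split.
  by rewrite leq_mul2r leq_subr orbT.
have zE : ((N - n)%N%:Z)%:~R = N%:R - n%:R :> R by rewrite -natrB.
by move: H; rewrite natrM intrD intrM zE natrB //; lra.
Qed.

(** * Sturmian sequences against their shifts *)

Lemma floor_diff0 (R : realType) (a t : R) (z : int) :
  0 <= a -> z%:~R <= t -> t + a < z%:~R + 1 ->
  Num.floor (t + a) - Num.floor t = 0.
Proof.
move=> a0 lo hi.
have -> : Num.floor (t + a) = z by apply: floor_def; rewrite intrD; lra.
have -> : Num.floor t = z by apply: floor_def; rewrite intrD; lra.
by rewrite subrr.
Qed.

Lemma floor_diff1 (R : realType) (a t : R) (z : int) :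
  a < 1 -> z%:~R + 1 <= t + a -> t < z%:~R + 1 -> z%:~R <= t ->
  Num.floor (t + a) - Num.floor t = 1.
Proof.
move=> a1 lo hi zt.
have -> : Num.floor (t + a) = z + 1 by apply: floor_def; rewrite !intrD; lra.
have -> : Num.floor t = z by apply: floor_def; rewrite intrD; lra.
by rewrite addrC addKr.
Qed.

(* With [d] the fractional part of [b]: if [d <= 1 - a], points just below an
   integer have floor difference 1 and their translates by [b] have 0; if
   [d > 1 - a], points just above an integer have 0 and their translates 1. *)
Lemma floor_diff_translate_neq (R : realType) (a b : R) :
  0 < a < 1 -> (forall z : int, b != z%:~R) ->
  exists u e : R, 0 < e /\ forall (t : R) (z : int),
    u + z%:~R <= t < u + z%:~R + e ->
    Num.floor (t + a) - Num.floor t <>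
    Num.floor (t + b + a) - Num.floor (t + b).
Proof.
move=> a01 bz; pose D := Num.floor b; pose d : R := b - D%:~R.
have d0 : 0 < d.
  by rewrite /d subr_gt0 lt_neqAle eq_sym bz /D floor_le.
have d1 : d < 1 by have := floor_itv b; rewrite /d /D intrD; lra.
have bE : b = D%:~R + d by rewrite /d addrC subrK.
case: (leP d (1 - a)) => da.
- have [ea ed] : Num.min a d <= a /\ Num.min a d <= d.
    by rewrite !ge_min !lexx orbT.
  exists (1 - Num.min a d), (Num.min a d).
  split=> [|t z ht]; first by rewrite lt_min d0; lra.
  rewrite (@floor_diff1 _ a t z); [|lra..].
  rewrite (@floor_diff0 _ a (t + b) (z + D + 1)) ?bE ?intrD //; lra.
have [ea ed] : Num.min (1 - a) (1 - d) <= 1 - a /\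
    Num.min (1 - a) (1 - d) <= 1 - d by rewrite !ge_min !lexx orbT.
exists 0, (Num.min (1 - a) (1 - d)).
split=> [|t z ht]; first by rewrite lt_min; lra.
rewrite (@floor_diff0 _ a t z); [|lra..].
rewrite (@floor_diff1 _ a (t + b) (z + D)) ?bE ?intrD //; lra.
Qed.

(** The shift by [d] translates the orbit by [d * alpha], and the rotation by [K * alpha] meets the
    interval where this changes the floor difference; [N] is uniform in [c]. *)
Lemma sturmian_progressions_differ (R : realType) (a : nat -> int)
    (K d : nat) : sturmian R a -> (0 < K)%N -> (0 < d)%N ->
  exists N : nat, forall c : nat, exists2 n : nat, (n <= N)%N &
    a (c + n * K)%N <> a (c + n * K + d)%N.
Proof.
move=> [alpha [beta [al be ia aE]]] K0 d0.
have al0 : 0 < alpha < 1.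
  case/andP: al => al ->; rewrite lt_neqAle al eq_sym !andbT.
  by have := irrational_natmul_neq 0 ia (ltn0Sn 0); rewrite mul1r.
have [u [e [e0 he]]] := floor_diff_translate_neq al0
  (fun z => irrational_natmul_neq z ia d0).
have [|N hN] := @rotation_hits_interval R (K%:R * alpha) u e _ e0.
  move=> n z n0; rewrite mulrA -natrM.
  by apply: irrational_natmul_neq; rewrite // muln_gt0 n0.
exists N => c; have [n [z [nN /he H]]] := hN (c.+1%:R * alpha + beta).
exists n => // E; apply: H; move: E; rewrite !aE.
have E1 : (c + n * K).+1%:R * alpha + beta =
    c.+1%:R * alpha + beta + n%:R * (K%:R * alpha).
  by rewrite -!natr1 !natrD natrM; ring.
have E2 : (c + n * K + d).+1%:R * alpha + beta =
    c.+1%:R * alpha + beta + n%:R * (K%:R * alpha) + d%:R * alpha.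
  by rewrite -!natr1 !natrD natrM; ring.
have S m : m.+2%:R * alpha + beta = m.+1%:R * alpha + beta + alpha.
  by rewrite -[m.+2%:R]natr1; ring.
by rewrite !S E1 E2.
Qed.

Local Close Scope ring_scope.

Lemma common_factorP (T : Type) (x a : nat -> T) (n : nat) :
  common_factor x a n ->
  exists i j, forall m, (m < n)%N -> x (i + m)%N = a (j + m)%N.
Proof.
move=> [w [<- [i wi] [j wj]]]; exists i, j => m mw.
rewrite -(nth_mkseq (x 0%N) (fun m => x (i + m)%N) mw) -wi.
by rewrite [in LHS]wj nth_mkseq.
Qed.

Theorem theorem1 (R : realType) (k : nat) (hk : (2 <= k)%N)
    (x : nat -> int) (hx : automatic k x)
    (a : nat -> int) (ha : sturmian R a) :
  exists C : nat, forall n : nat, common_factor x a n -> (n <= C)%N.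
Proof.
have [r [s [t [st tK xst]]]] := automatic_kernel_collision hk hx.
set K := (k ^ r)%N in tK xst.
have K0 : (0 < K)%N by rewrite expn_gt0 ltnW.
have d0 : (0 < t - s)%N by rewrite subn_gt0.
have [N hN] := sturmian_progressions_differ ha K0 d0.
(* At most [K] terms to reach a multiple of [K], at most [N] blocks, then an offset below [K]. *)
exists ((N + 2) * K)%N => L /common_factorP [i [j xa]].
rewrite leqNgt; apply/negP => LK.
(* The successor makes [n0] positive, as the collision requires, and puts [n0 * K] beyond [i]. *)
pose n0 := (i %/ K).+1; pose c := (n0 * K - i)%N.
have n0i : (i <= n0 * K)%N by rewrite ltnW // ltn_ceil.
have cK : (c <= K)%N.
  by rewrite /c /n0 leq_subLR mulSn addnC leq_add2r leq_trunc_div.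
(* Index [j + c + s] of [a] faces index [n0 * K + s] of [x]. *)
have [n nN] := hN (j + c + s)%N; apply.
have nK : (n * K <= N * K)%N by rewrite leq_mul2r nN orbT.
have xaE v : (v < K)%N ->
    x ((n0 + n) * K + v)%N = a (j + (c + n * K + v))%N.
  move=> vK; rewrite -xa; last by rewrite mulnDl in LK; lia.
  by congr x; rewrite mulnDl /c; lia.
have := xst (n0 + n)%N isT; rewrite !xaE //; last exact: ltn_trans tK.
by congr (a _ = a _); lia.
Qed.
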